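(* Let $d\ge 1$ and let $A\colon\mathbb{Z}\to M_d(\mathbb{R})$ be such that every $A(n)$, $n\in\mathbb{Z}$, is non-singular and there is $M>0$ with $\sup_{n\in\mathbb{Z}}\max\{\|A(n)\|,\|A(n)^{-1}\|\}\le M$. Let $\Sigma(A)=[a_1,b_1]\cup\dots\cup[a_\ell,b_\ell]$ be the exponential dichotomy spectrum (on $\mathbb{Z}$) of the system $x_{n+1}=A(n)x_n$, written as its union of spectral intervals with $a_i\le b_i<a_{i+1}$, and let $\mathcal{W}_1,\dots,\mathcal{W}_\ell$ be the associated invariant vector bundles, with fibers $\mathcal{W}_i(n)$. Then for every $i\in\{1,\dots,\ell\}$ and every $\xi_i\in\mathcal{W}_i(0)\setminus\{0\}$, the lower and upper Bohl exponents of the solution starting from $\xi_i$ at time $0$ satisfy $$[\underline{\beta}_A(\xi_i),\overline{\beta}_A(\xi_i)]\subseteq[a_i,b_i].$$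
   Context: Norms: $\|\cdot\|$ is a norm on $\mathbb{R}^d$ and the induced matrix norm on $M_d(\mathbb{R})$. Transition operator of $x_{n+1}=A(n)x_n$: $X(m,n)=A(m-1)\cdots A(n)$ if $m>n$, $X(m,m)=I$, and $X(m,n)=A(m)^{-1}\cdots A(n-1)^{-1}$ if $m<n$, for $m,n\in\mathbb{Z}$. Bohl exponents: for $\xi\in\mathbb{R}^d\setminus\{0\}$, the upper and lower Bohl exponents are $$\overline{\beta}_A(\xi)=\limsup_{m,\,n-m\to+\infty}\left(\frac{\|X(n,0)\xi\|}{\|X(m,0)\xi\|}\right)^{\frac{1}{n-m}},\qquad \underline{\beta}_A(\xi)=\liminf_{m,\,n-m\to+\infty}\left(\frac{\|X(n,0)\xi\|}{\|X(m,0)\xi\|}\right)^{\frac{1}{n-m}},$$ where $m,n$ are integers and the limsup/liminf are taken as both $m\to+\infty$ and $n-m\to+\infty$, i.e. they are $\lim_{N\to\infty}$ of the supremum/infimum over $m\ge N$, $n-m\ge N$. Invariant projector: a map $P\colon\mathbb{Z}\to M_d(\mathbb{R})$ with $P(k)^2=P(k)$ and $P(k+1)A(k)=A(k)P(k)$ for all $k\in\mathbb{Z}$. Exponential dichotomy on $\mathbb{Z}$: the system $x_{n+1}=A(n)x_n$ has an exponential dichotomy on $\mathbb{Z}$ if there are an invariant projector $P$ and constants $K>0$, $\rho\in(0,1)$ such that, for $k,l\in\mathbb{Z}$, $\|X(k,l)P(l)\|\le K\rho^{k-l}$ if $k\ge l$, and $\|X(k,l)[I-P(l)]\|\le K\rho^{l-k}$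 if $k\le l$. Spectrum and resolvent: $\Sigma(A)$ is the set of all $\gamma\in(0,+\infty)$ for which the system $x(n+1)=\frac1\gamma A(n)x(n)$ has no exponential dichotomy on $\mathbb{Z}$; the resolvent is $\rho(A)=(0,+\infty)\setminus\Sigma(A)$. Known fact: under the assumptions on $A$, $\Sigma(A)$ is a union of $\ell\le d$ closed intervals $[a_1,b_1]\cup\dots\cup[a_\ell,b_\ell]$ with $a_i\le b_i<a_{i+1}$ (the spectral intervals), and $\rho(A)=\rho_0(A)\cup\dots\cup\rho_\ell(A)$ with $\rho_0(A)=(0,a_1)$, $\rho_i(A)=(b_i,a_{i+1})$ for $1\le i<\ell$, and $\rho_\ell(A)=(b_\ell,+\infty)$. Invariant vector bundles: for $\gamma\in\rho(A)$, let $P_\gamma$ denote an invariant projector of the exponential dichotomy of $x(n+1)=\frac1\gamma A(n)x(n)$. Choose $\gamma_i\in\rho_i(A)$ for $i=0,\dots,\ell$. For $i=1,\dots,\ell$ and $n\in\mathbb{Z}$ the fibers are $\mathcal{W}_i(n)=\ker P_{\gamma_{i-1}}(n)\cap\operatorname{im}P_{\gamma_i}(n)$, and $\mathcal{W}_i=\bigcup_{n\in\mathbb{Z}}\{n\}\times\mathcal{W}_i(n)$. Known fact: these are independent of the choice of the $\gamma_i\in\rho_i(A)$. *)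

(* Defs.v *)
(* MathComp-Analysis; R : realType plays the role of the real numbers, vectors
   of R^d are columns 'cV[R]_d, and sequences over Z are functions on int. *)
From HB Require Import structures.
From mathcomp Require Import all_boot all_order all_algebra.
From mathcomp Require Import all_classical all_reals all_analysis.

Set Implicit Arguments.
Unset Strict Implicit.
Unset Printing Implicit Defensive.

Import Order.TTheory GRing.Theory Num.Theory.
Import numFieldNormedType.Exports.

Local Open Scope classical_set_scope.
Local Open Scope ring_scope.

Section Definitions.
Context {R : realType} {d : nat}.

(* The norm is an arbitrary one: the canonical `|x| on matrices is only the
   max norm, so the norm is carried as a function. *)
Definition is_norm (nrm : 'cV[R]_d -> R) : Prop :=
  [/\ forall x, 0 <= nrm x,
      forall x, nrm x = 0 -> x = 0,
      forall (c : R) x, nrm (c *: x) = `|c| * nrm x &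
      forall x y, nrm (x + y) <= nrm x + nrm y].

(* A supremum of a nonempty bounded set when 0 < d and nrm is a norm. *)
Definition induced_norm (nrm : 'cV[R]_d -> R) (B : 'M[R]_d) : R :=
  sup [set nrm (B *m x) | x in [set x | nrm x = 1]].

(* X(m,n) = A(m-1) ... A(n) if n <= m and X(m,n) = A(m)^-1 ... A(n-1)^-1 if
   m < n; \prod is the ordered matrix product, the identity when m = n. *)
Definition transition (A : int -> 'M[R]_d) (m n : int) : 'M[R]_d :=
  if n <= m
  then \prod_(j < `|m - n|%N) A (m - 1 - j%:Z)
  else \prod_(j < `|n - m|%N) invmx (A (m + j%:Z)).

Definition invariant_projector (A P : int -> 'M[R]_d) : Prop :=
  forall k : int, P k *m P k = P k /\ P (k + 1) *m A k = A k *m P k.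

Definition dichotomy_projector (nrm : 'cV[R]_d -> R)
    (A P : int -> 'M[R]_d) : Prop :=
  invariant_projector A P /\
  exists K rho : R, [/\ 0 < K, 0 < rho < 1,
    forall k l : int, l <= k ->
      induced_norm nrm (transition A k l *m P l) <= K * rho ^ (k - l) &
    forall k l : int, k <= l ->
      induced_norm nrm (transition A k l *m (1%:M - P l))
        <= K * rho ^ (l - k)].

Definition exponential_dichotomy (nrm : 'cV[R]_d -> R)
    (A : int -> 'M[R]_d) : Prop :=
  exists P, dichotomy_projector nrm A P.

Definition scaled_system (g : R) (A : int -> 'M[R]_d) : int -> 'M[R]_d :=
  fun n => g^-1 *: A n.

Definition spectrum (nrm : 'cV[R]_d -> R) (A : int -> 'M[R]_d) : set R :=
  [set g | 0 < g /\ ~ exponential_dichotomy nrm (scaled_system g A)].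

Definition resolvent (nrm : 'cV[R]_d -> R) (A : int -> 'M[R]_d) : set R :=
  `]0, +oo[%classic `\` spectrum nrm A.

(* The spectral intervals are [a 1, b 1], ..., [a l, b l]; the values of a and b
   at other indices are irrelevant. *)
Definition spectral_intervals (nrm : 'cV[R]_d -> R) (A : int -> 'M[R]_d)
    (l : nat) (a b : nat -> R) : Prop :=
  [/\ spectrum nrm A = \bigcup_(i in [set i | (1 <= i <= l)%N]) `[a i, b i]%classic,
      forall i, (1 <= i <= l)%N -> a i <= b i &
      forall i, (1 <= i < l)%N -> b i < a i.+1].

(* rho_0 = (0, a_1), rho_i = (b_i, a_{i+1}) and rho_l = (b_l, +oo), for
   0 <= i <= l. *)
Definition resolvent_interval (l : nat) (a b : nat -> R) (i : nat) : set R :=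
  let lo := if i == 0%N then 0 else b i in
  if (i < l)%N then `]lo, a i.+1[%classic else `]lo, +oo[%classic.

(* P g is a projector for the parameter g, and gam i a parameter in rho_i. *)
Definition bundle_fiber (P : R -> int -> 'M[R]_d) (gam : nat -> R)
    (i : nat) (n : int) : set 'cV[R]_d :=
  [set x | P (gam i.-1) n *m x = 0] `&` range (mulmx (P (gam i) n)).

(* The quotients defining the Bohl exponents of xi, over the integers m and n
   with m >= N and n - m >= N; at n - m = 0 the exponent is 0^-1 = 0, which is
   harmless as only N -> +oo matters. *)
Definition bohl_quotients (nrm : 'cV[R]_d -> R) (A : int -> 'M[R]_d)
    (xi : 'cV[R]_d) (N : nat) : set (\bar R) :=
  [set ((nrm (transition A p.2 0 *m xi) / nrm (transition A p.1 0 *m xi))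
          `^ ((p.2 - p.1)%:~R)^-1)%:E
    | p in [set p : int * int | N%:Z <= p.1 /\ N%:Z <= p.2 - p.1]].

Definition upper_bohl (nrm : 'cV[R]_d -> R) (A : int -> 'M[R]_d)
    (xi : 'cV[R]_d) : \bar R :=
  limn (fun N => ereal_sup (bohl_quotients nrm A xi N)).

Definition lower_bohl (nrm : 'cV[R]_d -> R) (A : int -> 'M[R]_d)
    (xi : 'cV[R]_d) : \bar R :=
  limn (fun N => ereal_inf (bohl_quotients nrm A xi N)).

End Definitions.

(* Main.v *)
Require Import Defs.
From HB Require Import structures.
From mathcomp Require Import all_boot all_order all_algebra.
From mathcomp Require Import all_classical all_reals all_analysis.
From mathcomp Require Import ring lra zify.

Set Implicit Arguments.
Unset Strict Implicit.
Unset Printing Implicit Defensive.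

Import Order.TTheory GRing.Theory Num.Theory.
Import numFieldNormedType.Exports.

Local Open Scope classical_set_scope.
Local Open Scope ring_scope.

(** Write [x k = X(k,0) xi] for the solution through [xi]. The proof compares
the growth of [x] with pure exponentials, uniformly over all starting times:
[growth_bound nrm x s] says that [nrm (x (k + n)) <= K s^n nrm (x k)] for one
constant [K]. If such a bound holds for [x], the upper Bohl exponent is at most
any number above [s] ([upper_bohl_le]), since the [n]-th root makes [K]
negligible. If it holds for the time-reversed solution [k |-> x (- k)], the
solution cannot decay faster than [s^-n] in forward time, and the lower Bohl
exponent is at least any number below [s^-1] ([lower_bohl_ge]). So it suffices
to obtain a bound for [x] at every rate above [b i], and one for the reversed
solution at every rate above [(a i)^-1].

A dichotomy at [g] splits [x k = P k x k + (1 - P k) x k] into a part that grows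
at rate at most [rho g] and a part whose reversal grows at rate at most
[rho / g], for some [rho < 1] ([scaled_dichotomy_growth]). A vector of the fiber
[W_i(0)] lies in the image of the projector at [gam i] and in the kernel of the
one at [gam (i-1)], which gives the two bounds at one point of each of the
resolvent intervals adjacent to [[a i, b i]].

These bounds have to be carried to the end of the intervals, which amounts to
the independence of the bundles from the choice of the parameters. Suppose that
[x] is known to grow at a rate [s] only slightly larger than a resolvent point
[g], in the sense that [rho s < g]. The complementary part [(1 - P k) x k] is
controlled by [x] at arbitrarily late times with a factor [(rho / g)^n], so it
is bounded by a multiple of [(rho s / g)^n] and vanishes
([growth_bound_trapped]). Hence [x] grows at rate [rho g < g]. The infimum of
the admissible rates therefore cannot be an interior point of the resolvent
interval ([descent]). The same argument for the reversed solution, in the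
variable [g^-1], reaches [(a i)^-1]. *)

(** * The norm on column vectors and its induced matrix norm *)

Section Norms.
Context {R : realType} {d : nat}.
Variable nrm : 'cV[R]_d -> R.
Hypothesis nrmP : is_norm nrm.

Lemma nrm_ge0 x : 0 <= nrm x. Proof. by case: nrmP. Qed.
Lemma nrm_eq0 x : nrm x = 0 -> x = 0.
Proof. by case: nrmP => _ + _ _; apply. Qed.
Lemma nrmZ c x : nrm (c *: x) = `|c| * nrm x. Proof. by case: nrmP. Qed.
Lemma ler_nrmD x y : nrm (x + y) <= nrm x + nrm y. Proof. by case: nrmP. Qed.
Lemma nrm0 : nrm 0 = 0.
Proof. by rewrite -(scale0r 0) nrmZ normr0 mul0r. Qed.
Lemma nrm_gt0 x : x != 0 -> 0 < nrm x.
Proof.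
move=> x0; rewrite lt_def nrm_ge0 andbT.
by apply: contra x0 => /eqP /nrm_eq0 ->.
Qed.

Lemma nrm_sum_le I (r : seq I) (F : I -> 'cV[R]_d) :
  nrm (\sum_(i <- r) F i) <= \sum_(i <- r) nrm (F i).
Proof.
elim/big_ind2: _ => [|a b c e ab ce|//]; first by rewrite nrm0.
by apply: le_trans (ler_nrmD _ _) (lerD _ _).
Qed.

Lemma coord_le_norm n (v : 'rV[R]_n) i : `|v ord0 i| <= `|v|.
Proof.
rewrite [leRHS]/Num.norm /= mx_normrE; apply/bigmax_geP; right => /=.
by exists (ord0, i).
Qed.

Lemma linear_image_bound (B : 'M[R]_d) :
  exists2 C, 0 < C & forall v : 'rV[R]_d, nrm (B *m v^T) <= C * `|v|.
Proof.
pose S := \sum_(j < d) nrm (B *m (delta_mx 0 j : 'rV[R]_d)^T).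
have S0 : 0 <= S by apply: sumr_ge0 => j _; exact: nrm_ge0.
exists (S + 1); first by rewrite ltr_wpDl.
move=> v; apply: (@le_trans _ _ (S * `|v|)); last first.
  by rewrite ler_wpM2r// lerDl.
rewrite {1}[v]row_sum_delta linear_sum /= mulmx_sumr.
apply: le_trans (nrm_sum_le _ _) _.
rewrite /S mulr_suml; apply: ler_sum => j _.
rewrite linearZ /= -scalemxAr nrmZ mulrC ler_wpM2l ?nrm_ge0//.
exact: coord_le_norm.
Qed.

(** The norm is Lipschitz for the max norm, hence continuous, and so attains a
minimum on the compact unit sphere of the max norm; this minimum is positive
because the norm is definite. *)
Lemma max_norm_bound : (0 < d)%N ->
  exists2 c, 0 < c & forall v : 'rV[R]_d, c * `|v| <= nrm v^T.
Proof.
move=> d0; pose f (v : 'rV[R]_d) := nrm v^T.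
have [C C0 HC] := linear_image_bound 1%:M.
have fC v : f v <= C * `|v| by have := HC v; rewrite mul1mx.
have fD u v : f u - f v <= C * `|u - v|.
  apply: le_trans (fC _); rewrite lerBlDr /f.
  by rewrite -{1}(subrK v u) linearD /=; exact: ler_nrmD.
have fdist u v : `|f u - f v| <= C * `|u - v|.
  by rewrite ler_norml fD andbT lerNl opprB distrC; exact: fD.
have fcont : continuous f.
  move=> v; apply/(@cvgrPdist_lt _ _ _ _ (nbhs_filter v)) => e e0.
  have B := @nbhsx_ballx _ 'rV[R]_d v (e / C) (divr_gt0 e0 C0).
  rewrite -ball_normE in B; apply: filterS B => u /= uv.
  by apply: le_lt_trans (fdist _ _) _; rewrite mulrC -ltr_pdivlMr.
pose S := [set v : 'rV[R]_d | `|v| = 1].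
have Sb : bounded_set S.
  by exists 1; split => // M M1 v /= ->; exact: ltW.
have Sc : closed S.
  have -> : S = (fun v : 'rV[R]_d => `|v|) @^-1` [set 1] by [].
  apply: preimage_closed; first by move=> v _; exact: norm_continuous.
  exact: closed_eq.
have normalized v : v != 0 :> 'rV[R]_d -> S (`|v|^-1 *: v).
  by move=> v0; rewrite /S /= mx_normZ normfV normr_id mulVf// normr_eq0.
have Sn : S !=set0.
  exists (`|const_mx 1 : 'rV[R]_d|^-1 *: const_mx 1); apply: normalized.
  apply/eqP => /rowP /(_ (Ordinal d0)); rewrite !mxE => /eqP.
  by rewrite oner_eq0.
have [c cS cmin] := EVT_min_rV Sn (bounded_closed_compact Sb Sc)
  (continuous_subspaceT fcont).
exists (f c).
  apply: nrm_gt0; apply/eqP => c0.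
  move: cS; rewrite inE /S /= => /eqP.
  by rewrite -(trmxK c) c0 trmx0 normr0 eq_sym oner_eq0.
move=> v; have [->|v0] := eqVneq v 0; first by rewrite normr0 mulr0 nrm_ge0.
have v_gt0 : 0 < `|v| by rewrite normr_gt0.
have /cmin := mem_set (normalized v v0).
rewrite {2}/f linearZ /= nrmZ normfV normr_id.
by rewrite mulrC ler_pdivlMr.
Qed.

(** A supremum of real numbers carries information only if the set is bounded
above, and [max_norm_bound] provides such a bound for the values of [B] on the
unit sphere of [nrm]. *)
Lemma nrm_mulmx_le (B : 'M[R]_d) (x : 'cV[R]_d) :
  nrm (B *m x) <= induced_norm nrm B * nrm x.
Proof.
have [->|x0] := eqVneq x 0; first by rewrite mulmx0 nrm0 mulr0.
have d0 : (0 < d)%N.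
  case: (posnP d) => // d0; move/eqP: x0; case; apply/colP => i.
  by have := ltn_ord i; rewrite {2}d0.
have [c c0 Hc] := max_norm_bound d0.
have [C C0 HC] := linear_image_bound B.
have nx := nrm_gt0 x0.
rewrite -ler_pdivrMr// mulrC -[X in X * _]gtr0_norm ?invr_gt0//.
rewrite -nrmZ scalemxAr.
apply: ub_le_sup; last first.
  exists ((nrm x)^-1 *: x) => //=.
  by rewrite nrmZ gtr0_norm ?invr_gt0// mulVf// gt_eqF.
exists (C / c) => _ [y /= ny <-].
have := HC y^T; have := Hc y^T; rewrite trmxK ny => h1 h2.
apply: le_trans h2 _; rewrite ler_wpM2l ?(ltW C0)//.
by rewrite -[leRHS]mul1r ler_pdivlMr// mulrC.
Qed.
End Norms.

(** * Solutions of linear difference equations over the integers *)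

Section Solutions.
Context {R : realType} {d : nat}.
Implicit Types (A P : int -> 'M[R]_d) (x z : int -> 'cV[R]_d).

Lemma transition_id A m : transition A m m = 1%:M.
Proof. by rewrite /transition lexx subrr big_ord0. Qed.

(** The two branches of [transition] obey one recursion in the first argument,
so [k |-> X(k,l) v] is a solution on all of the integers. *)
Lemma transition_succ A (m n : int) : (forall k, A k \in unitmx) ->
  transition A (m + 1) n = A m *m transition A m n.
Proof.
move=> uA; rewrite /transition; have [nm|mn] := leP n m.
  rewrite ifT; last by lia.
  have -> : `|(m + 1)%R - n|%N = `|m - n|%N.+1 by lia.
  rewrite big_ord_recl; congr (A _ *m _); first by rewrite /=; lia.
  by apply: eq_bigr => j _; congr (A _); rewrite lift0; lia.
have -> : `|n - m|%N = `|n - (m + 1)%R|%N.+1 by lia.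
rewrite big_ord_recl addr0 (mulKVmx (uA m)).
have [nm|nm] := leP n (m + 1).
  have -> : n = m + 1 by lia.
  by rewrite subrr !big_ord0.
by apply: eq_bigr => j _; congr (invmx (A _)); rewrite lift0; lia.
Qed.

Definition solution A x := forall k, x (k + 1) = A k *m x k.

(** With invertible coefficients the value at one time determines a solution
both forward and backward. This replaces the cocycle identities for the transition
matrices: two expressions agree as soon as both solve the equation and agree at
a single time. *)
Lemma solution_uniq A x z (l : int) : (forall k, A k \in unitmx) ->
  solution A x -> solution A z -> x l = z l -> forall k, x k = z k.
Proof.
move=> uA sx sz xz k; rewrite -(subrK l k) addrC.
elim/int_ind: (k - l) => [|n|n]; first by rewrite addr0.
  move=> IH; have -> : l + n.+1%:Z = (l + n%:Z) + 1 by lia.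
  by rewrite sx sz IH.
move=> IH; have e : l - n%:Z = (l - n.+1%:Z) + 1 by lia.
by rewrite -(mulKmx (uA (l - n.+1%:Z)) (x _)) -sx -e IH e sz mulKmx.
Qed.

Lemma solution_transition A l (v : 'cV[R]_d) : (forall k, A k \in unitmx) ->
  solution A (fun k => transition A k l *m v).
Proof. by move=> uA k; rewrite transition_succ// mulmxA. Qed.

Lemma solution_projector A P x : invariant_projector A P -> solution A x ->
  solution A (fun k => P k *m x k).
Proof. by move=> iP sx k; rewrite sx !mulmxA (iP k).2. Qed.

Lemma solution_scaled g A x : g != 0 -> solution A x ->
  solution (scaled_system g A) (fun k => g^-1 ^ k *: x k).
Proof.
move=> g0 sx k; rewrite sx /scaled_system -scalemxAl -scalemxAr scalerA.
by rewrite exprzDr ?unitfE ?invr_eq0// mulrC.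
Qed.
End Solutions.

(** * Real sequences and a descent principle *)

Section Analysis.
Context {R : realType}.

Lemma geometric_le0 (C q t : R) : 0 <= q < 1 ->
  (forall n, t <= C * q ^+ n) -> t <= 0.
Proof.
move=> /andP[q0 q1] H.
have L : (C * q ^+ n @[n --> \oo]) --> (0 : R).
  by apply: cvg_geometric; rewrite ger0_norm.
rewrite -(cvg_lim _ L)//; apply: limr_ge; first by apply/cvg_ex; exists 0.
by near=> n; exact: H.
Unshelve. all: by end_near. Qed.

Lemma eventually_absorb_constant (K s t : R) : 0 < s < t ->
  exists N, forall n, (N <= n)%N -> K * s ^+ n <= t ^+ n.
Proof.
move=> /andP[s0 st]; have t0 := lt_trans s0 st.
have L : (K * (s / t) ^+ n @[n --> \oo]) --> (0 : R).
  by apply: cvg_geometric; rewrite ger0_norm ?divr_ge0 ?ltW// ltr_pdivrMr ?mul1r.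
have [N _ HN] := cvgr_lt _ L _ (ltr01 : 0 < 1 :> R).
exists N => n /HN /ltW /=.
by rewrite expr_div_n mulrA ler_pdivrMr ?exprn_gt0// mul1r.
Qed.

Lemma root_exprn (s : R) n : (0 < n)%N -> 0 <= s ->
  (s ^+ n) `^ (n%:R)^-1 = s.
Proof.
move=> n0 s0; rewrite -powR_mulrn// -powRrM divff ?powRr1//.
by rewrite pnatr_eq0 -lt0n.
Qed.

Lemma root_mono (s t : R) n : 0 <= s -> s <= t ->
  s `^ (n%:R)^-1 <= t `^ (n%:R)^-1.
Proof.
move=> s0 st; apply: ge0_ler_powR => //; rewrite nnegrE//.
exact: le_trans st.
Qed.

(** If [inf S] were above [c], some admissible [t] would be so close to [inf S]
that [t * rho < inf S]; the last hypothesis then makes a rate below [inf S]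
admissible. *)
Lemma descent (c g0 : R) (good : R -> Prop) : 0 <= c < g0 ->
  (forall s t, 0 < s -> s <= t -> good s -> good t) -> good g0 ->
  (forall s, c < s <= g0 -> exists2 rho, 0 < rho < 1 &
     forall t, 0 < t -> t * rho < s -> good t -> good (rho * s)) ->
  forall s, c < s -> good s.
Proof.
move=> /andP[c0 cg0] mono good_g0 step s cs; apply: contrapT => bad_s.
pose S := [set t | c < t <= g0 /\ good t].
have s_lb : lbound S s.
  move=> t [/andP[ct _] good_t]; rewrite leNgt; apply/negP => ts.
  by apply/bad_s/(mono t); rewrite ?(ltW ts)//; exact: le_lt_trans ct.
have S_g0 : S g0 by split=> //; rewrite cg0 lexx.
have S_inf : has_inf S by split; [exists g0|exists s].
have s_le : s <= inf S by apply: lb_le_inf => //; exists g0.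
have c_inf : c < inf S by exact: lt_le_trans s_le.
have inf_g0 : inf S <= g0 by apply: ge_inf => //; exists s.
have inf_gt0 : 0 < inf S by exact: le_lt_trans c_inf.
have [rho /andP[rho0 rho1] Hrho] := step (inf S) ltac:(by rewrite c_inf inf_g0).
(* The tolerance is chosen so that [t < inf S / rho]. *)
have [t [/andP[ct tg0] good_t] tlt] := @inf_adherent _ S (inf S / rho - inf S)
  ltac:(by rewrite subr_gt0 ltr_pdivlMr// gtr_pMr) S_inf.
rewrite addrC subrK ltr_pdivlMr// in tlt.
have good_below := Hrho t (le_lt_trans c0 ct) tlt good_t.
(* The rate [rho * inf S] may fall below [c]; its maximum with the midpoint of
   [c] and [inf S] stays in the range that defines [S]. *)
pose r := Num.max (rho * inf S) ((c + inf S) / 2).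
have r_lt : r < inf S.
  by rewrite /r gt_max gtr_pMl// rho1 /=; lra.
have S_r : S r.
  split.
    apply/andP; split; last by apply: le_trans inf_g0; exact: ltW.
    by rewrite /r lt_max; apply/orP; right; lra.
  by apply: mono good_below; rewrite ?mulr_gt0// /r le_max lexx.
have : inf S <= r by apply: ge_inf => //; exists s.
by rewrite leNgt r_lt.
Qed.
End Analysis.

(** * Exponential growth of solutions under a dichotomy *)

Section Growth.
Context {R : realType} {d : nat}.
Variable nrm : 'cV[R]_d -> R.
Hypothesis nrmP : is_norm nrm.
Implicit Types (x z v : int -> 'cV[R]_d) (A P : int -> 'M[R]_d).

(** The constant is uniform in the starting time [k], as Bohl exponents require;
a bound on [nrm (x n) / nrm (x 0)] alone would only control Lyapunov exponents.
*)
Definition growth_bound x (s : R) : Prop :=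
  exists2 K, 0 < K &
    forall (k : int) (n : nat), nrm (x (k + n%:Z)) <= K * s ^+ n * nrm (x k).

Definition reversed x : int -> 'cV[R]_d := fun k => x (- k).

Lemma growth_bound_mono x s t : 0 < s -> s <= t ->
  growth_bound x s -> growth_bound x t.
Proof.
move=> s0 st [K K0 H]; exists K => // k n; apply: le_trans (H k n) _.
rewrite ler_wpM2r ?nrm_ge0// ler_wpM2l ?(ltW K0)//.
by rewrite lerXn2r// nnegrE ltW// (lt_le_trans s0).
Qed.

(** Passing from [A] to [g^-1 A] multiplies solutions by [g^-k] and rates by
[g^-1]. *)
Lemma growth_bound_scale x c s : 0 < c ->
  growth_bound (fun k => c ^ k *: x k) (c * s) <-> growth_bound x s.
Proof.
move=> c0.
have E K (k : int) (n : nat) :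
    (nrm (c ^ (k + n%:Z) *: x (k + n%:Z))
      <= K * (c * s) ^+ n * nrm (c ^ k *: x k)) =
    (nrm (x (k + n%:Z)) <= K * s ^+ n * nrm (x k)).
  rewrite !(nrmZ nrmP) exprzDr ?unitfE ?gt_eqF// !gtr0_norm ?mulr_gt0 ?exprz_gt0//.
  rewrite -exprnP exprMn.
  have -> : K * (c ^+ n * s ^+ n) * (c ^ k * nrm (x k)) =
    c ^ k * c ^+ n * (K * s ^+ n * nrm (x k)) by ring.
  by rewrite ler_pM2l// mulr_gt0 ?exprz_gt0 ?exprn_gt0.
by split=> -[K K0 H]; exists K => // k n; move: (H k n); rewrite E.
Qed.

(** Here [v] is the part of [z] that the dichotomy does not control forward in
time. Combining the backward estimate for [v] with the growth of [z] gives
[nrm (v k) <= C (s rho)^n] for all [n], so [v = 0] and the forward estimate for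
[z - v] holds for [z] itself. *)
Lemma growth_bound_trapped z v K rho s :
  0 < K -> 0 < rho -> 0 < s -> s * rho < 1 ->
  (forall (k : int) (n : nat),
     nrm (z (k + n%:Z) - v (k + n%:Z)) <= K * rho ^+ n * nrm (z k)) ->
  (forall (k : int) (n : nat), nrm (v k) <= K * rho ^+ n * nrm (z (k + n%:Z))) ->
  growth_bound z s -> growth_bound z rho.
Proof.
move=> K0 rho0 s0 srho Hu Hv [K' K'0 Hz].
have v0 k : v k = 0.
  apply: (nrm_eq0 nrmP); apply/eqP; rewrite eq_le nrm_ge0// andbT.
  apply: (@geometric_le0 _ (K * K' * nrm (z k)) (s * rho)).
    by rewrite srho mulr_ge0 ?ltW.
  move=> n; apply: le_trans (Hv k n) _.
  have -> : K * K' * nrm (z k) * (s * rho) ^+ n =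
    K * rho ^+ n * (K' * s ^+ n * nrm (z k)) by rewrite exprMn; ring.
  by rewrite ler_wpM2l// mulr_ge0 ?exprn_ge0 ?ltW.
by exists K => // k n; have := Hu k n; rewrite v0 subr0.
Qed.

(** By invariance [k |-> P k z k] and its complement are again solutions, so the
operators [X(k,l) P(l)] and [X(k,l) (1 - P(l))] transport these two components
of [z] in time. *)
Lemma dichotomy_splitting A P z : (forall k, A k \in unitmx) ->
  dichotomy_projector nrm A P -> solution A z ->
  exists K rho, [/\ 0 < K, 0 < rho < 1,
    forall (k : int) (n : nat), nrm (P (k + n%:Z) *m z (k + n%:Z))
      <= K * rho ^+ n * nrm (z k) &
    forall (k : int) (n : nat), nrm (z k - P k *m z k)
      <= K * rho ^+ n * nrm (z (k + n%:Z))].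
Proof.
move=> uA [iP [K [rho [K0 rho01 Hs Hu]]]] sz; exists K, rho.
have transport y : solution A y ->
    forall k l, transition A k l *m y l = y k.
  move=> sy k l.
  apply: (solution_uniq uA (solution_transition l (y l) uA) sy (l := l)).
  by rewrite transition_id mul1mx.
have sPz := solution_projector iP sz.
split=> // k n.
  rewrite -(transport _ sPz (k + n%:Z) k) mulmxA.
  apply: le_trans (nrm_mulmx_le nrmP _ _) _.
  rewrite ler_wpM2r ?nrm_ge0//.
  have := Hs (k + n%:Z) k; rewrite (_ : k + n%:Z - k = n%:Z); last by lia.
  by apply; lia.
have sQz : solution A (fun k => z k - P k *m z k).
  by move=> j; rewrite mulmxBr sz -sz sPz.
rewrite -(transport _ sQz k (k + n%:Z)) -{1}[z (k + n%:Z)]mul1mx -mulmxBl mulmxA.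
apply: le_trans (nrm_mulmx_le nrmP _ _) _.
rewrite ler_wpM2r ?nrm_ge0//.
have := Hu k (k + n%:Z); rewrite (_ : k + n%:Z - k = n%:Z); last by lia.
by apply; lia.
Qed.

(** Time reversal exchanges the roles of the two components, so the statements
about [reversed z] come from the same two estimates as those about [z]. *)
Lemma dichotomy_growth A P z : (forall k, A k \in unitmx) ->
  dichotomy_projector nrm A P -> solution A z ->
  exists2 rho, 0 < rho < 1 & [/\
    P 0 *m z 0 = z 0 -> growth_bound z rho,
    P 0 *m z 0 = 0 -> growth_bound (reversed z) rho,
    forall s, 0 < s -> s * rho < 1 ->
      growth_bound z s -> growth_bound z rho &
    forall s, 0 < s -> s * rho < 1 ->
      growth_bound (reversed z) s -> growth_bound (reversed z) rho].
Proof.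
move=> uA HP sz; have [K [rho [K0 rho01 Hs Hu]]] := dichotomy_splitting uA HP sz.
have /andP[rho0 _] := rho01.
have sPz := solution_projector HP.1 sz.
have s0 : solution A (fun=> 0) by move=> k; rewrite mulmx0.
have back (k : int) (n : nat) : - (k + n%:Z) + n%:Z = - k by lia.
exists rho => //; split.
- move=> P0; exists K => // k n.
  by have := Hs k n; rewrite (solution_uniq uA sPz sz P0).
- move=> P0; exists K => // k n; have := Hu (- (k + n%:Z)) n.
  by rewrite back (solution_uniq uA sPz s0 P0) subr0.
- move=> s s_gt0 srho.
  apply: (@growth_bound_trapped z (fun k => z k - P k *m z k) K) => //.
  by move=> k n; rewrite subKr.
- move=> s s_gt0 srho.
  apply: (@growth_bound_trapped _ (fun k => P (- k) *m z (- k)) K) => // k n.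
    by have := Hu (- (k + n%:Z)) n; rewrite back.
  by have := Hs (- (k + n%:Z)) n; rewrite back.
Qed.

Lemma scaled_dichotomy_growth g A P x : 0 < g -> (forall k, A k \in unitmx) ->
  dichotomy_projector nrm (scaled_system g A) P -> solution A x ->
  exists2 rho, 0 < rho < 1 & [/\
    P 0 *m x 0 = x 0 -> growth_bound x (rho * g),
    P 0 *m x 0 = 0 -> growth_bound (reversed x) (rho * g^-1),
    forall s, 0 < s -> s * rho < g ->
      growth_bound x s -> growth_bound x (rho * g) &
    forall s, 0 < s -> s * rho < g^-1 ->
      growth_bound (reversed x) s -> growth_bound (reversed x) (rho * g^-1)].
Proof.
move=> g0 uA HP sx; have gi0 : 0 < g^-1 by rewrite invr_gt0.
have g_neq0 : g != 0 by rewrite gt_eqF.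
have uB k : scaled_system g A k \in unitmx.
  by rewrite /scaled_system unitmxZ// unitfE invr_eq0.
have [rho rho01 []] := dichotomy_growth uB HP (solution_scaled g_neq0 sx).
have Ef s : growth_bound (fun k => g^-1 ^ k *: x k) s <-> growth_bound x (s * g).
  by rewrite -(growth_bound_scale x (s * g) gi0) mulrC mulfK.
have Eb s : growth_bound (reversed (fun k => g^-1 ^ k *: x k)) s <->
    growth_bound (reversed x) (s * g^-1).
  rewrite -(growth_bound_scale (reversed x) (s / g) g0) mulrC divfK//.
  rewrite (_ : reversed _ = (fun k => g ^ k *: reversed x k))//.
  by apply/funext => k; rewrite /reversed exprz_inv opprK.
rewrite expr0z scale1r => H1 H2 H3 H4; exists rho => //; split.
- by move=> /H1 /Ef.
- by move=> /H2 /Eb.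
- move=> s s0 srho xs; apply/Ef; apply: (H3 (s / g)).
  + exact: divr_gt0.
  + by rewrite mulrAC ltr_pdivrMr ?mul1r.
  + by apply/Ef; rewrite divfK.
- move=> s s0 srho xs; apply/Eb; apply: (H4 (s * g)).
  + exact: mulr_gt0.
  + by rewrite mulrAC -ltr_pdivlMr// mul1r.
  + by apply/Eb; rewrite mulfK.
Qed.
End Growth.

(** * Bohl exponents and growth bounds *)

Section Bohl.
Context {R : realType} {d : nat}.
Variable nrm : 'cV[R]_d -> R.
Hypothesis nrmP : is_norm nrm.
Variables (A : int -> 'M[R]_d) (xi : 'cV[R]_d).
Let x k := transition A k 0 *m xi.

Lemma bohl_quotientsP N y : bohl_quotients nrm A xi N y ->
  exists (k : int) (n : nat), (N <= n)%N /\
    y = ((nrm (x (k + n%:Z)) / nrm (x k)) `^ (n%:R)^-1)%:E.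
Proof.
move=> [[m p] /= [_ Np] <-]; exists m, `|p - m|%N; split; first by lia.
have -> : p - m = `|p - m|%N%:Z by lia.
by have -> : m + `|p - m|%N%:Z = p by lia.
Qed.

Lemma bohl_quotients_decr M N : (M <= N)%N ->
  bohl_quotients nrm A xi N `<=` bohl_quotients nrm A xi M.
Proof.
by move=> MN y [p [p1 p2] <-]; exists p => //; split; lia.
Qed.

(** The constant of the growth bound disappears for long time intervals:
[K s^n <= t^n] for large [n]. *)
Lemma upper_bohl_le s t : 0 < s < t -> growth_bound nrm x s ->
  (upper_bohl nrm A xi <= t%:E)%E.
Proof.
move=> st [K K0 H]; have [N HN] := eventually_absorb_constant K st.
have /andP[s0 /ltW/(le_trans (ltW s0)) t0] := st.
rewrite /upper_bohl (cvg_lim _ (ereal_nonincreasing_cvgn _))//; last first.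
  by move=> M M' MM'; apply: le_ereal_sup; exact: bohl_quotients_decr.
apply: le_trans (ereal_inf_lbound _) _; first by exists N.+1.
apply: ge_ereal_sup => y /bohl_quotientsP[k [n [Nn ->]]].
rewrite lee_fin -[leRHS](@root_exprn _ t n)//; last by lia.
apply: root_mono; first by rewrite divr_ge0 ?nrm_ge0.
apply: le_trans (HN n (ltnW Nn)).
have [x0|x0] := eqVneq (nrm (x k)) 0.
  by rewrite x0 invr0 mulr0 mulr_ge0 ?exprn_ge0 ?ltW.
by rewrite ler_pdivrMr// lt_def x0 nrm_ge0.
Qed.

(** A growth bound read backwards in time is a lower bound for the quotients;
the solution must not vanish, since the quotient by [0] is [0]. *)
Lemma lower_bohl_ge s t : 0 < s < t -> (forall k, x k != 0) ->
  growth_bound nrm (reversed x) s ->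
  ((t^-1)%:E <= lower_bohl nrm A xi)%E.
Proof.
move=> st x0 [K K0 H]; have [N HN] := eventually_absorb_constant K st.
have /andP[s0 /(lt_trans s0) t0] := st.
rewrite /lower_bohl (cvg_lim _ (ereal_nondecreasing_cvgn _))//; last first.
  by move=> M M' MM'; apply: le_ereal_inf; exact: bohl_quotients_decr.
apply: (@le_trans _ _ (ereal_inf (bohl_quotients nrm A xi N.+1))); last first.
  by apply: ereal_sup_ubound; exists N.+1.
apply: le_ereal_inf_tmp => y /bohl_quotientsP[k [n [Nn ->]]].
rewrite lee_fin -[leLHS](@root_exprn _ t^-1 n) ?invr_ge0 ?(ltW t0)//; last by lia.
apply: root_mono; first by rewrite exprn_ge0// invr_ge0 ltW.
rewrite ler_pdivlMr ?nrm_gt0// exprVn mulrC ler_pdivrMr ?exprn_gt0//.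
have := H (- (k + n%:Z)) n.
rewrite /reversed opprK (_ : - (- (k + n%:Z) + n%:Z) = k); last by lia.
move=> /le_trans; apply.
by rewrite mulrC ler_wpM2l ?nrm_ge0// HN// ltnW.
Qed.
End Bohl.

(** * Spectral intervals and the resolvent intervals between them *)

Section Resolvent.
Context {R : realType} {d : nat}.
Variables (nrm : 'cV[R]_d -> R) (A : int -> 'M[R]_d) (l : nat) (a b : nat -> R).
Hypothesis hS : spectral_intervals nrm A l a b.

Lemma spectral_gt0 i : (1 <= i <= l)%N -> 0 < a i.
Proof.
case: hS => E ab _ il; have : spectrum nrm A (a i).
  by rewrite E; exists i => //=; rewrite in_itv /= lexx ab.
by case.
Qed.

Lemma spectral_intervals_lt j k : (1 <= j)%N -> (j < k <= l)%N -> b j < a k.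
Proof.
case: hS => _ ab ba j1; elim: k => [//|k IH] /andP[jk kl].
have [->|jk'] := eqVneq j k; first by apply: ba; lia.
apply: (@lt_trans _ _ (b k)); last by apply: ba; lia.
by apply: (@lt_le_trans _ _ (a k)); [apply: IH|apply: ab]; lia.
Qed.

Lemma resolvent_interval_sub i : (i <= l)%N ->
  resolvent_interval l a b i `<=` resolvent nrm A.
Proof.
case: (hS) => E ab _ il g; rewrite /resolvent_interval => gi.
have lo : (if i == 0%N then 0 else b i) < g.
  by move: gi; case: ifP => _ /=; rewrite in_itv /= => /andP[].
have hi : (i < l)%N -> g < a i.+1.
  by move=> il'; move: gi; rewrite il' /= in_itv /= => /andP[].
split.
  rewrite /= in_itv /= andbT; move: lo; case: eqP => // i0; apply: lt_trans.
  have il' : (1 <= i <= l)%N by lia.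
  exact: lt_le_trans (spectral_gt0 il') (ab _ il').
rewrite E => -[j /= jl]; rewrite in_itv /= => /andP[ajg gbj].
have [ji|ij] := leqP j i.
  move: lo; rewrite ifF; last by lia.
  rewrite ltNge; case/negP; apply: le_trans gbj _.
  have [->//|ji'] := eqVneq j i.
  apply: (@le_trans _ _ (a i)); last by apply: ab; lia.
  by apply/ltW/spectral_intervals_lt; lia.
have il' : (i < l)%N by lia.
suff aij : a i.+1 <= a j by have := lt_le_trans (hi il') aij; rewrite ltNge ajg.
have [->//|ij'] := eqVneq i.+1 j.
apply: (@le_trans _ _ (b i.+1)); first by apply: ab; lia.
by apply/ltW/spectral_intervals_lt; lia.
Qed.
End Resolvent.

(** * Bohl exponents of solutions starting in a spectral bundle *)

Theorem corollary1 (R : realType) (d : nat) (hd : (1 <= d)%N)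
  (nrm : 'cV[R]_d -> R) (hnrm : is_norm nrm)
  (A : int -> 'M[R]_d) (hA : forall n, A n \in unitmx)
  (hM : exists2 M : R, 0 < M &
    forall n, Num.max (induced_norm nrm (A n)) (induced_norm nrm (invmx (A n)))
              <= M)
  (l : nat) (a b : nat -> R) (hS : spectral_intervals nrm A l a b)
  (P : R -> int -> 'M[R]_d)
  (hP : forall g, g \in resolvent nrm A ->
    dichotomy_projector nrm (scaled_system g A) (P g))
  (gam : nat -> R)
  (hgam : forall i, (i <= l)%N -> gam i \in resolvent_interval l a b i) :
  forall i, (1 <= i <= l)%N ->
  forall xi : 'cV[R]_d, xi \in bundle_fiber P gam i 0 -> xi != 0 ->
    `[lower_bohl nrm A xi, upper_bohl nrm A xi]%classic `<=` `[(a i)%:E, (b i)%:E]%classic.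
Proof.
move=> i il xi xiW xi0.
have [xi_ker xi_im] := set_mem xiW.
pose x k := transition A k 0 *m xi.
have sx : solution A x by exact: solution_transition.
have x0 : x 0 = xi by rewrite /x transition_id mul1mx.
have x_neq0 k : x k != 0.
  apply: contra xi0 => /eqP xk0; rewrite -x0; apply/eqP.
  apply: (solution_uniq hA sx (z := fun=> 0) _ (l := k)) => //.
  by move=> j; rewrite mulmx0.
have a0 := spectral_gt0 hS il.
have b0 : 0 < b i by case: hS => _ ab _; exact: lt_le_trans (ab _ il).
have step g j : (j <= l)%N -> resolvent_interval l a b j g ->
    0 < g /\ dichotomy_projector nrm (scaled_system g A) (P g).
  move=> jl /(resolvent_interval_sub hS jl) gr; split; last exact/hP/mem_set.
  by case: gr => /=; rewrite in_itv /= andbT.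
have forward s : b i < s -> growth_bound nrm x s.
  have gami := set_mem (hgam i ltac:(lia)).
  have iN0 : (i == 0)%N = false by lia.
  have below g : b i < g <= gam i -> resolvent_interval l a b i g.
    move=> /andP[bg ggam]; move: gami; rewrite /resolvent_interval iN0.
    case: ifP => _ /=; rewrite !in_itv /= bg ?andbT// => /andP[_].
    exact: le_lt_trans.
  have bgam : b i < gam i.
    move: gami; rewrite /resolvent_interval iN0.
    by case: ifP => _ /=; rewrite in_itv /= => /andP[].
  have [|gam0 D] := step (gam i) i _ gami; first by lia.
  apply: (descent (g0 := gam i)).
  - by rewrite bgam ltW.
  - by move=> s1 s2; exact: growth_bound_mono.
  - have [rho /andP[rho0 rho1] [H _ _ _]] := scaled_dichotomy_growth hnrm gam0 hA D sx.
    apply: (growth_bound_mono hnrm (mulr_gt0 rho0 gam0)); last first.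
      apply: H; rewrite x0; case: xi_im => y _ <-.
      by rewrite mulmxA (D.1 0).1.
    by rewrite ger_pMl// ltW.
  - move=> g /below gi; have [|g0 Dg] := step g i _ gi; first by lia.
    have [rho rho01 [_ _ H _]] := scaled_dichotomy_growth hnrm g0 hA Dg sx.
    by exists rho.
have backward s : (a i)^-1 < s -> growth_bound nrm (reversed x) s.
  have gami := set_mem (hgam i.-1 ltac:(lia)).
  have iP : i.-1.+1 = i by lia.
  have above g : gam i.-1 <= g < a i -> resolvent_interval l a b i.-1 g.
    move=> /andP[gg ga]; move: gami; rewrite /resolvent_interval ifT; last by lia.
    rewrite iP /= !in_itv /= ga andbT => /andP[lo _].
    exact: lt_le_trans gg.
  have gama : gam i.-1 < a i.
    move: gami; rewrite /resolvent_interval ifT; last by lia.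
    by rewrite iP /= in_itv /= => /andP[].
  have [|gam0 D] := step (gam i.-1) i.-1 _ gami; first by lia.
  apply: (descent (g0 := (gam i.-1)^-1)).
  - by rewrite ltf_pV2// gama invr_ge0 ltW.
  - by move=> s1 s2; exact: growth_bound_mono.
  - have [rho /andP[rho0 rho1] [_ H _ _]] := scaled_dichotomy_growth hnrm gam0 hA D sx.
    have gamV0 : 0 < (gam i.-1)^-1 by rewrite invr_gt0.
    apply: (growth_bound_mono hnrm (mulr_gt0 rho0 gamV0)); last first.
      by apply: H; rewrite x0.
    by rewrite ger_pMl// ltW.
  - move=> g /andP[ag ggam].
    have g0 : 0 < g by apply: lt_trans ag; rewrite invr_gt0.
    have gi : resolvent_interval l a b i.-1 g^-1.
      apply: above; rewrite -[gam _]invrK lef_pV2 ?posrE ?invr_gt0// ggam /=.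
      by rewrite -[a i]invrK ltf_pV2 ?posrE ?invr_gt0.
    have [|gV0 Dg] := step _ i.-1 _ gi; first by lia.
    have [rho rho01 [_ _ _ H]] := scaled_dichotomy_growth hnrm gV0 hA Dg sx.
    by rewrite invrK in H; exists rho.
move=> y /=; rewrite !in_itv /= => /andP[ly yu].
apply/andP; split.
  apply: le_trans ly; apply/lee_subgt0Pr => e e0.
  (* [a i - e] may be negative, whereas [lower_bohl_ge] needs a positive rate. *)
  pose t := Num.max (a i - e) (a i / 2).
  have /andP[t0 ta] : 0 < t < a i.
    by rewrite /t lt_max gt_max; apply/andP; split; [apply/orP; right|apply/andP; split]; lra.
  apply: (@le_trans _ _ t%:E); first by rewrite lee_fin /t le_max lexx.
  have aV : (a i)^-1 < t^-1 by rewrite ltf_pV2.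
  rewrite -[t]invrK.
  apply: (lower_bohl_ge hnrm (s := ((a i)^-1 + t^-1) / 2)) => //.
    by have : 0 < (a i)^-1 by [rewrite invr_gt0]; lra.
  by apply: backward; lra.
apply: le_trans yu _; apply/lee_addgt0Pr => e e0.
apply: (upper_bohl_le hnrm (s := b i + e / 2)); first by lra.
by apply: forward; lra.
Qed.
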